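(* Every countable group $L$ without Kazhdan's property (T) (for instance, every countable infinite amenable group $L$) embeds as a subgroup into a countable group $G$ such that $(G,L)$ is a flabby pair.
   Context: Flabby pair: let $G$ be a countable group and $L$ a subgroup. The pair $(G,L)$ is flabby if there exists a unitary representation $(\mathcal{H},\pi)$ of $G$ with no non-zero $\pi(L)$-invariant vectors with the property that for any sequence $(F_n)$ of finite subsets of $L$ whose sizes tend to infinity, there exists a sequence $(s_n)$ in $G$ such that $\lim_n\big\|\frac{1}{|F_n|}\sum_{s\in F_n}\pi(ss_n)v\big\|=1$ for some unit vector $v\in\mathcal{H}$. Weak containment: for separable unitary representations $(\mathcal{H}_\pi,\pi)$, $(\mathcal{H}_\rho,\rho)$ of a countable group $L$, $\pi$ is weakly contained in $\rho$ if for every $v\in\mathcal{H}_\pi$, every finite $F\subset L$ and every $\varepsilon>0$ there exist $w_1,\dots,w_k\in\mathcal{H}_\rho$ with $|\langle v,\pi(s)v\rangle-\sum_{i=1}^k\langle w_i,\rho(s)w_i\rangle|<\varepsilon$ for all $s\in F$. Property (T): a countable group $L$ has Kazhdan's property (T) if every unitary representation $(\mathcal{H},\rho)$ of $L$ which weakly contains the identity (trivial one-dimensional) representation has a non-zero $\rho(L)$-invariant vector. *)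

(* Defs.v *)
From HB Require Import structures.
From mathcomp Require Import all_boot all_order all_algebra.
From mathcomp Require Import finmap.
From mathcomp Require Import complex.
From mathcomp Require Import all_classical all_reals all_analysis.

Set Implicit Arguments.
Unset Strict Implicit.
Unset Printing Implicit Defensive.

Import Order.TTheory GRing.Theory Num.Theory.
Import numFieldNormedType.Exports.

Local Open Scope classical_set_scope.
Local Open Scope fset_scope.
Local Open Scope complex_scope.
Local Open Scope ring_scope.

(* Norms of a normedModType over R[i] take their (real, nonnegative) values in
   R[i]; Sesquilinear's {dot H for conjC} is linear in its first argument and
   conjugate-linear in the second. *)
Record hilbertSpace (R : realType) := HilbertSpace {
  hilbert_sort :> completeNormedModType R[i];
  inner : {dot hilbert_sort for (@Num.conj R[i])};
  inner_norm : forall v : hilbert_sort, `|v| ^+ 2 = inner v v }.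

Definition separable (T : topologicalType) :=
  exists D : set T, countable D /\ dense D.

(* rep_op s is invertible, with inverse rep_op s^-1, so that preservation of
   the inner product makes it unitary. *)
Record unitaryRep (R : realType) (G : groupType) := UnitaryRep {
  rep_space : hilbertSpace R;
  rep_op :> G -> {linear rep_space -> rep_space};
  rep_op1 : forall v, rep_op 1%g v = v;
  rep_opM : forall s t v, rep_op (s * t)%g v = rep_op s (rep_op t v);
  rep_op_inner : forall s v w,
    inner rep_space (rep_op s v) (rep_op s w) = inner rep_space v w }.

Definition invariant_vector (R : realType) (G : groupType)
    (pi : unitaryRep R G) (L : set G) (v : rep_space pi) :=
  forall s, L s -> pi s v = v.

Definition weakly_contained (R : realType) (L : groupType)
    (pi rho : unitaryRep R L) :=
  forall (v : rep_space pi) (F : {fset L}) (eps : R), 0 < eps ->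
  exists (k : nat) (w : 'I_k -> rep_space rho),
  forall s, s \in F ->
    `|inner _ v (pi s v) - \sum_(i < k) inner _ (w i) (rho s (w i))| < eps%:C.

Section ComplexHilbert.
Variable R : realType.

Lemma complex_ReB (x y : R[i]) : complex.Re (x - y) = complex.Re x - complex.Re y.
Proof. by case: x y => a b [c d]. Qed.

Lemma complex_ImB (x y : R[i]) : complex.Im (x - y) = complex.Im x - complex.Im y.
Proof. by case: x y => a b [c d]. Qed.

Lemma ltcR_norm (z : R[i]) (e : R) : `|z| < e%:C -> `|complex.Re z| < e /\ `|complex.Im z| < e.
Proof.
rewrite normc_def ltcR => ze.
have sqrt_le (a b : R) : `|a| <= Num.sqrt (a ^+ 2 + b ^+ 2).
  by rewrite -sqrtr_sqr ler_wsqrtr// lerDl sqr_ge0.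
by split; apply: le_lt_trans ze; rewrite // addrC.
Qed.

Lemma ltcR_normD (z : R[i]) (e : R) :
  `|complex.Re z| < e / 2 -> `|complex.Im z| < e / 2 -> `|z| < e%:C.
Proof.
case: z => a b /= ha hb.
have -> : a +i* b = a%:C + 'i * b%:C by rewrite -complexiE; simpc.
rewrite (le_lt_trans (ler_normD _ _))// normrM normCi mul1r !normc_def /=.
rewrite !expr0n /= !addr0 !sqrtr_sqr -rmorphD ltcR.
by rewrite [ltRHS]splitr ltrD.
Qed.

Lemma complex_complete (F : set_system (R[i])^o) :
  ProperFilter F -> cauchy F -> cvg F.
Proof.
move=> FF /cauchyP Fc.
have FRe : cvg (@complex.Re R @ F : set_system R).
  apply: R_complete; apply/cauchyP => e e0.
  have e0' : 0 < e%:C :> R[i] by rewrite ltcR.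
  have [x Fx] := Fc _ e0'.
  exists (complex.Re x).
  change (F (fun y : R[i] => `|complex.Re x - complex.Re y| < e)).
  apply: filterS Fx => y xy.
  by have [+ _] := @ltcR_norm ((x : R[i]) - y) e xy; rewrite complex_ReB.
have FIm : cvg (@complex.Im R @ F : set_system R).
  apply: R_complete; apply/cauchyP => e e0.
  have e0' : 0 < e%:C :> R[i] by rewrite ltcR.
  have [x Fx] := Fc _ e0'.
  exists (complex.Im x).
  change (F (fun y : R[i] => `|complex.Im x - complex.Im y| < e)).
  apply: filterS Fx => y xy.
  by have [_ +] := @ltcR_norm ((x : R[i]) - y) e xy; rewrite complex_ImB.
apply/cvg_ex; exists (lim (@complex.Re R @ F) +i* lim (@complex.Im R @ F) : (R[i])^o).
apply/cvgrPdist_lt => e e0.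
have er : e = (complex.Re e)%:C
  by case: e e0 => a b; rewrite ltcE /= => /andP[/eqP-> _].
have re0 : 0 < complex.Re e / 2 by rewrite divr_gt0// -ltcR -er.
move/cvgrPdist_lt: FRe => /(_ _ re0) FRe.
move/cvgrPdist_lt: FIm => /(_ _ re0) FIm.
have hr : F (fun y : R[i] =>
  `|lim (@complex.Re R @ F) - complex.Re y| < complex.Re e / 2) := FRe.
have hi : F (fun y : R[i] =>
  `|lim (@complex.Im R @ F) - complex.Im y| < complex.Re e / 2) := FIm.
apply: filterS (filterI hr hi) => y [{}hr {}hi]; rewrite er; apply: ltcR_normD.
  by rewrite complex_ReB.
by rewrite complex_ImB.
Qed.

Definition complex_completeNormedMod : completeNormedModType R[i] :=
  HB.pack_for (completeNormedModType R[i]) (R[i])^o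
    (Uniform_isComplete.Build (R[i])^o complex_complete).

Definition complex_inner (x y : complex_completeNormedMod) : R[i] :=
  (x : R[i]) * Num.conj (y : R[i]).

Lemma complex_inner_bilinear :
  bilinear_for *%R (@Num.conj R[i] \; *%R) complex_inner.
Proof.
split=> u a x y; rewrite /complex_inner /=.
  by rewrite mulrDl mulrA.
by rewrite rmorphD rmorphM mulrDr mulrCA.
Qed.

HB.instance Definition _ := @bilinear_isBilinear.Build R[i]
  complex_completeNormedMod complex_completeNormedMod R[i]
  *%R (@Num.conj R[i] \; *%R) complex_inner complex_inner_bilinear.

Lemma complex_inner_hermitian (x y : complex_completeNormedMod) :
  complex_inner x y = (-1) ^+ false * Num.conj (complex_inner y x).
Proof. by rewrite /complex_inner expr0 mul1r rmorphM /= conjCK mulrC. Qed.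

HB.instance Definition _ := @isHermitianSesquilinear.Build R[i]
  complex_completeNormedMod false (@Num.conj R[i]) complex_inner
  complex_inner_hermitian.

Lemma complex_inner_gt0 (x : complex_completeNormedMod) :
  x != 0 -> 0 < complex_inner x x.
Proof. by move=> x0; rewrite /complex_inner -normCK exprn_gt0// normr_gt0. Qed.

HB.instance Definition _ := @isDotProduct.Build R[i]
  complex_completeNormedMod complex_inner complex_inner_gt0.

Lemma complex_inner_norm (x : complex_completeNormedMod) :
  `|x| ^+ 2 = complex_inner x x.
Proof. exact: normCK. Qed.

Definition complex_hilbertSpace : hilbertSpace R :=
  @HilbertSpace R complex_completeNormedMod complex_inner complex_inner_norm.

End ComplexHilbert.

Definition trivial_rep (R : realType) (L : groupType) : unitaryRep R L :=
  @UnitaryRep R L (complex_hilbertSpace R) (fun=> idfun)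
    (fun=> erefl) (fun _ _ _ => erefl) (fun _ _ _ => erefl).

(* Weak containment is a relation between separable representations; the
   trivial representation, acting on C, is always one. *)
Definition property_T (R : realType) (L : groupType) :=
  forall rho : unitaryRep R L,
    separable (rep_space rho) -> weakly_contained (trivial_rep R L) rho ->
  exists v : rep_space rho, v <> 0 /\ invariant_vector [set: L] v.

(* L is a subset of G, meant to be the underlying set of a subgroup. *)
Definition flabby_pair (R : realType) (G : groupType) (L : set G) :=
  exists pi : unitaryRep R G,
    (forall v : rep_space pi, invariant_vector L v -> v = 0) /\
    forall F : nat -> {fset G},
      (forall n s, s \in F n -> L s) ->
      (fun n => #|` F n|) @ \oo --> \oo ->
    exists (t : nat -> G) (v : rep_space pi),
      `|v| = 1 /\
      (fun n => `|#|` F n|%:R^-1 *: \sum_(s <- F n) pi (s * t n)%g v|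
         : (R[i])^o) @ \oo --> (1 : (R[i])^o).

(* The Folner condition, with left translates and symmetric differences. *)
Definition amenable (L : groupType) :=
  forall (K : {fset L}) (eps : rat), 0 < eps ->
  exists F : {fset L}, F != fset0 /\
    forall g, g \in K ->
      let gF := [fset (g * x)%g | x in F] in
      #|` (gF `\` F) `|` (F `\` gF)|%:R <= eps * #|` F|%:R.

(* Main.v *)
Require Import Defs.
From HB Require Import structures.
From mathcomp Require Import all_boot all_order all_algebra.
From mathcomp Require Import finmap.
From mathcomp Require Import complex ring lra.
From mathcomp Require Import all_classical all_reals all_analysis summability.

Set Implicit Arguments.
Unset Strict Implicit.
Unset Printing Implicit Defensive.

Import Order.TTheory GRing.Theory Num.Theory.
Import numFieldNormedType.Exports.

Local Open Scope classical_set_scope.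
Local Open Scope fset_scope.
Local Open Scope complex_scope.
Local Open Scope ring_scope.

(* Let rho be a representation of L that weakly contains the trivial one and has
   no nonzero invariant vector. It has, for every finite subset F of L, a unit
   vector w_F that every s in F moves by less than 1/(|F|+1), and, for a fixed
   unit vector v, w_F may be rotated so that <v, w_F> is real; then a reflection
   T_F exchanges v and w_F. Let G be the subgroup of L x U(H) generated by the
   (s, rho s) and the (1, T_F), acting on H by the second projection. Taking
   s_n = (1, T_F) with F = F_n, the mean of the s s_n v over F_n is the mean of
   the rho(s) w_F, within 1/(|F|+1) of the unit vector w_F.

   An infinite amenable group does not have (T) because the normalized
   indicators of Folner sets are almost invariant in its regular representation,
   while an invariant element of l^2 is constant, hence zero. *)

(** * Countable subgroups and unitary groups *)

Section CountableSubgroup.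
Variables (I : countType) (G : groupType) (gen : I -> G).

(** A letter is an index with a sign: [true] for the generator, [false] for its inverse. Words over
    the countable type [I] are countable. *)
Definition gen_word (w : seq (bool * I)) : G :=
  foldr (fun a x => (if a.1 then gen a.2 else (gen a.2)^-1) * x)%g 1%g w.

Lemma gen_word_cat w1 w2 : gen_word (w1 ++ w2) = (gen_word w1 * gen_word w2)%g.
Proof. by elim: w1 => [|a w IH] /=; rewrite ?mul1g// IH mulgA. Qed.

Lemma gen_wordV w :
  gen_word (rev [seq (~~ a.1, a.2) | a <- w]) = (gen_word w)^-1%g.
Proof.
elim: w => [|[b n] w IH] /=; first by rewrite invg1.
rewrite rev_cons -cats1 gen_word_cat IH /= mulg1 invgM.
by case: b; rewrite ?invgK.
Qed.

Definition generated : pred G := fun x => `[< exists w, gen_word w = x >].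

Lemma generated_group_closed : group_closed generated.
Proof.
split; first by apply/asboolP; exists [::].
move=> _ _ /asboolP[w1 <-] /asboolP[w2 <-]; apply/asboolP.
by exists (w1 ++ rev [seq (~~ a.1, a.2) | a <- w2]); rewrite gen_word_cat gen_wordV.
Qed.

Definition generated_type := {x : G | generated x}.

HB.instance Definition _ := SubChoice.on generated_type.
HB.instance Definition _ :=
  SubChoice_isSubGroup.Build G generated generated_type generated_group_closed.

Lemma generated_countable : countable [set: generated_type].
Proof.
have mem w : generated (gen_word w) by apply/asboolP; exists w.
pose f (w : seq (bool * I)) : generated_type := exist _ (gen_word w) (mem w).
have -> : [set: generated_type] = range f.
  apply/seteqP; split=> // -[x Px] _; have [w wx] := asboolP _ Px.
  by exists w => //; apply: val_inj.
exact: sub_countable (card_image_le _ _) _.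
Qed.

(** The interface used below: the subgroup is seen only through an injective morphism [i] that
    reaches every generator. *)
Lemma countable_subgroup : exists (K : groupType) (i : K -> G),
  [/\ countable [set: K], injective i, {morph i : x y / (x * y)%g},
      i 1%g = 1%g & forall n, exists k, i k = gen n].
Proof.
exists (generated_type : groupType), val; split.
- exact: generated_countable.
- exact: val_inj.
- by move=> x y; rewrite gmulfM.
- by rewrite gmulf1.
- move=> n; have gn : generated (gen n).
    by apply/asboolP; exists [:: (true, n)]; rewrite /= mulg1.
  by exists (exist _ (gen n) gn).
Qed.

End CountableSubgroup.

(** * Inner products: Cauchy-Schwarz and the triangle inequality *)

Section DotTheory.
Variables (C : numClosedFieldType) (U : lmodType C) (form : {dot U for @Num.conj C}).
Implicit Types u v w : U.

Lemma dotC u v : form u v = (form v u)^*.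
Proof. by rewrite hermC expr0 mul1r. Qed.

Lemma dotDl u v w : form (u + v) w = form u w + form v w.
Proof. exact: linearDl. Qed.

Lemma dotBl u v w : form (u - v) w = form u w - form v w.
Proof. exact: linearBl. Qed.

Lemma dotBr u v w : form u (v - w) = form u v - form u w.
Proof. exact: linearBr. Qed.

Lemma dotZl a u v : form (a *: u) v = a * form u v.
Proof. exact: linearZl_LR. Qed.

Lemma dotZr a u v : form u (a *: v) = a^* * form u v.
Proof. exact: linearZr_LR. Qed.

Definition dotE := (dotBl, dotBr, dotZl, dotZr).

(** Positivity of the squared norm of [u] minus its projection on [v]. *)
Lemma dot_CauchySchwarz u v : `|form u v| ^+ 2 <= form u u * form v v.
Proof.
have [->|v0] := eqVneq v 0; first by rewrite !linear0r normr0 expr0n ?mulr0.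
have vv : 0 < form v v by rewrite dnorm_gt0.
have := dnorm_ge0 form (u - (form u v / form v v) *: v).
rewrite !dotE (dotC v u) fmorph_div/= (CrealP (gtr0_real vv)).
set a := form u v; set b := form v v in vv *.
have b0 : b != 0 by rewrite gt_eqF.
rewrite (_ : _ - _ - _ = form u u - `|a| ^+ 2 / b); last by rewrite normCK; field.
by rewrite subr_ge0 ler_pdivrMr.
Qed.

(** After squaring, the cross term is twice a real part, which Cauchy-Schwarz bounds. This becomes
    the triangle inequality of l^2. *)
Lemma sqrt_dnormD_le u v :
  sqrtC (form (u + v) (u + v)) <= sqrtC (form u u) + sqrtC (form v v).
Proof.
rewrite -ler_sqr ?nnegrE ?addr_ge0 ?sqrtC_ge0 ?dnorm_ge0//.
rewrite sqrrD !sqrtCK addrAC dnormD lerD2l/=.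
apply: (@le_trans _ _ (2 * 'Re (form u v))).
  by rewrite ReE mulrC divfK// pnatr_eq0.
rewrite -[leRHS]mulr_natl ler_pM2l//.
rewrite (le_trans (leif_Re_Creal _).1)//.
rewrite -ler_sqr ?nnegrE ?mulr_ge0 ?sqrtC_ge0 ?dnorm_ge0//.
by rewrite exprMn !sqrtCK dot_CauchySchwarz.
Qed.

End DotTheory.

Section UnitaryGroup.
Variables (R : realType) (H : hilbertSpace R).

(** The inverse is stored as data, so that group inversion swaps two fields; [unitaryP] shows that
    [uop] determines it. *)
Record unitary := Unitary {
  uop :> H -> H;
  uinv : H -> H;
  uop_linear : linear uop;
  uop_inner : forall v w, inner H (uop v) (uop w) = inner H v w;
  uopK : cancel uop uinv;
  uinvK : cancel uinv uop }.

Lemma unitaryP (u v : unitary) : uop u =1 uop v -> u = v.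
Proof.
case: u v => [f f' fl fi fK fK'] [g g' gl gi gK gK'] /= /funext fg.
move: fl fi fK fK'; rewrite {}fg => fl fi fK fK'.
have E : f' = g' by apply/funext => x; rewrite -[x in LHS]gK' fK.
move: fK fK'; rewrite {}E => fK fK'.
by congr Unitary; exact: Prop_irrelevance.
Qed.

HB.instance Definition _ := gen_eqMixin unitary.
HB.instance Definition _ := gen_choiceMixin unitary.

Definition unitary1 : unitary :=
  @Unitary id id (fun _ _ _ => erefl) (fun _ _ => erefl) (fun=> erefl) (fun=> erefl).

Program Definition unitaryM (u v : unitary) : unitary :=
  @Unitary (u \o v) (uinv v \o uinv u) _ _ _ _.
Next Obligation. by move=> u v a x y /=; rewrite !uop_linear. Qed.
Next Obligation. by move=> u v x y /=; rewrite !uop_inner. Qed.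
Next Obligation. by move=> u v x /=; rewrite !uopK. Qed.
Next Obligation. by move=> u v x /=; rewrite !uinvK. Qed.

Program Definition unitaryV (u : unitary) : unitary :=
  @Unitary (uinv u) u _ _ (@uinvK u) (@uopK u).
Next Obligation.
by move=> u a x y /=; apply: (can_inj (@uopK u)); rewrite uop_linear !uinvK.
Qed.
Next Obligation. by move=> u v w /=; rewrite -(uop_inner u) !uinvK. Qed.

Lemma unitaryMA : associative unitaryM. Proof. by move=> *; exact: unitaryP. Qed.
Lemma unitary1M : left_id unitary1 unitaryM. Proof. by move=> *; exact: unitaryP. Qed.
Lemma unitaryM1 : right_id unitary1 unitaryM. Proof. by move=> *; exact: unitaryP. Qed.
Lemma unitaryVM : left_inverse unitary1 unitaryV unitaryM.
Proof. by move=> u; apply: unitaryP => x; exact: uopK. Qed.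
Lemma unitaryMV : right_inverse unitary1 unitaryV unitaryM.
Proof. by move=> u; apply: unitaryP => x; exact: uinvK. Qed.

HB.instance Definition _ :=
  isGroup.Build unitary unitaryMA unitary1M unitaryM1 unitaryVM unitaryMV.

HB.instance Definition _ (u : unitary) :=
  GRing.isLinear.Build R[i] H H _ (uop u) (uop_linear u).

Definition unitary_rep (G : groupType) (f : G -> unitary)
    (f1 : f 1%g = 1%g) (fM : {morph f : x y / (x * y)%g}) : unitaryRep R G.
Proof.
apply: (@UnitaryRep R G H (fun g => uop (f g) : {linear H -> H})).
- by move=> v /=; rewrite f1.
- by move=> s t v /=; rewrite fM.
- by move=> s v w /=; rewrite uop_inner.
Defined.

End UnitaryGroup.

Definition unitary_of_rep (R : realType) (G : groupType) (pi : unitaryRep R G)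
  (s : G) : unitary (rep_space pi).
Proof.
apply: (@Unitary R _ (pi s) (pi s^-1%g)).
- exact: linearP.
- exact: rep_op_inner.
- by move=> v; rewrite -rep_opM mulVg rep_op1.
- by move=> v; rewrite -rep_opM mulgV rep_op1.
Defined.

Lemma unitary_of_repM (R : realType) (G : groupType) (pi : unitaryRep R G) :
  {morph unitary_of_rep pi : x y / (x * y)%g}.
Proof. by move=> s t; apply: unitaryP => v /=; rewrite rep_opM. Qed.

(** * Reflections exchanging two vectors *)

Section Reflection.
Variables (R : realType) (H : hilbertSpace R).
Implicit Types v w : H.

(** For [u = 0] the coefficient multiplies the zero vector and the map is the identity, which fits
    the case [v = w] of [reflection_swap]. *)
Definition reflection (u x : H) : H :=
  x - (2 * inner H x u / inner H u u) *: u.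

Lemma reflection_linear u : linear (reflection u).
Proof.
move=> a x y; rewrite /reflection dotDl dotZl scalerBr scalerA addrACA -opprD -scalerDl.
congr (_ - _ *: _); ring.
Qed.

Lemma reflectionK u : involutive (reflection u).
Proof.
move=> x; rewrite /reflection dotBl dotZl.
have [->|u0] := eqVneq u 0; first by rewrite !scaler0 !subr0.
have uu : inner H u u != 0 by rewrite dnorm_eq0.
rewrite divfK// -addrA -opprD -scalerDl.
set a := (X in X *: u).
suff -> : a = 0 by rewrite scale0r subr0.
by rewrite /a; field.
Qed.

Lemma reflection_inner u x y :
  inner H (reflection u x) (reflection u y) = inner H x y.
Proof.
rewrite /reflection !dotE.
have [->|u0] := eqVneq u 0; first by rewrite !linear0r !(mulr0, mul0r, subr0).
have uu : inner H u u != 0 by rewrite dnorm_eq0.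
have cuu : (inner H u u)^* = inner H u u.
  by apply/CrealP/ger0_real; exact: dnorm_ge0.
rewrite !rmorphM fmorphV /= conjC_nat cuu (dotC _ u y).
set a := Num.conj _; set b := inner H x u; set c := inner H u u in uu *.
by field.
Qed.

Definition reflection_unitary (u : H) : unitary H :=
  Unitary (reflection_linear u) (reflection_inner u) (reflectionK u) (reflectionK u).

(** With [u = v - w], the hypotheses give [<u, u> = 2 <v, u>], so the coefficient of [u] is 1 and
    [v] goes to [v - u = w]. *)
Lemma reflection_swap v w : inner H v v = inner H w w ->
  inner H v w \is Num.real -> reflection (v - w) v = w.
Proof.
move=> vw rvw; have [/eqP vwE|nz] := eqVneq (v - w) 0.
  by move: vwE; rewrite subr_eq0 => /eqP->; rewrite subrr /reflection scaler0 subr0.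
have E : inner H (v - w) (v - w) = 2 * inner H v (v - w).
  rewrite !dotE vw (dotC _ w v) (CrealP rvw).
  ring.
rewrite /reflection -E divff ?scale1r ?dnorm_eq0//.
by rewrite opprB addrC subrK.
Qed.

End Reflection.

(** * Almost invariant vectors and the flabby pair *)

Lemma ltr_hilbert_norm (R : realType) (H : hilbertSpace R) (v : H) (a : R[i]) :
  0 < a -> (`|v| < a) = (inner H v v < a ^+ 2).
Proof.
by move=> a0; rewrite -inner_norm ltr_sqr// nnegrE// ltW.
Qed.

(* Summing over i and over s in F the squared displacements of the vectors w_i
   given by weak containment yields less than e^2 times the sum of their squared
   norms, so a single w_i, once normalized, satisfies the bound. *)
Lemma exists_almost_invariant (R : realType) (L : groupType)
    (rho : unitaryRep R L) : weakly_contained (trivial_rep R L) rho ->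
  forall (F : {fset L}) (e : R), 0 < e ->
  exists w : rep_space rho, inner _ w w = 1 /\
    forall s, s \in F -> `|rho s w - w| < e%:C.
Proof.
move=> wc F e e0; set K : R := #|` F|%:R.
have K0 : 0 <= K by rewrite ler0n.
have p0 : 0 < e ^+ 2 + 4 * K + 1 by rewrite ltr_wpDl// addr_ge0 ?sqr_ge0// mulr_ge0.
(* [d] solves [e ^+ 2 * (1 - d) - 4 * K * d = d], whence the strict inequality [dK]. *)
pose d := e ^+ 2 / (e ^+ 2 + 4 * K + 1).
have d0 : 0 < d by rewrite divr_gt0// exprn_gt0.
have dK : 4 * K * d < e ^+ 2 * (1 - d).
  rewrite -subr_gt0 [ltRHS](_ : _ = d); first by [].
  by rewrite /d; field; rewrite gt_eqF.
(* Adding [1] to [F] also puts the sum of the squared norms of the [w i] within [d] of 1. *)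
have [k [w Hw]] := wc (1 : R[i]) (1%g |` F) d d0.
have {}Hw s : s \in 1%g |` F ->
    `|1 - \sum_(i < k) inner _ (w i) (rho s (w i))| < d%:C.
  move=> /Hw; suff -> : inner (rep_space (trivial_rep R L))
    (1 : R[i]) (trivial_rep R L s (1 : R[i])) = 1 by [].
  by rewrite /= /complex_inner mul1r conjC1.
pose n i := inner _ (w i) (w i).
have n_ge0 i : 0 <= n i by exact: dnorm_ge0.
have HN : `|1 - \sum_i n i| < d%:C.
  have := Hw _ (fset1U1 1%g F).
  by under eq_bigr do rewrite rep_op1.
pose q i s := inner _ (rho s (w i) - w i) (rho s (w i) - w i).
have q_ge0 i s : 0 <= q i s by exact: dnorm_ge0.
have qE s : s \in F -> \sum_i q i s <= 4 * d%:C.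
  move=> sF; have {}Hw := Hw _ (fset1Ur 1%g sF).
  set Z := \sum_(i < k) _ in Hw.
  (* Each difference from 1 is below [d] in norm, which yields the bound [4 * d]. *)
  have E : \sum_i q i s = - 2 * (1 - \sum_i n i) + (1 - Z) + (1 - Z)^*.
    have -> : \sum_i q i s = 2 * (\sum_i n i) - Z - Z^*.
      rewrite mulr_sumr /Z rmorph_sum/= -!sumrB; apply: eq_bigr => i _.
      rewrite /q dotBl !dotBr rep_op_inner (dotC _ (rho s _)) /n; ring.
    rewrite rmorphB rmorph1; ring.
  have : 0 <= \sum_i q i s by exact: sumr_ge0.
  move=> /ger0_norm <-; rewrite E.
  rewrite (le_trans (ler_normD _ _))// (le_trans (lerD (ler_normD _ _) (lexx _)))//.
  rewrite norm_conjC normrM normrN normr_nat.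
  have -> : 4 * d%:C = 2 * d%:C + d%:C + d%:C by ring.
  by rewrite !lerD// ?ler_pM2l ?ltr0n// ltW.
have eC0 : 0 < e%:C by rewrite ltcR.
have [i Hi] : exists i, \sum_(s <- F) q i s < e%:C ^+ 2 * n i.
  apply: contrapT => /forallNP nH.
  have : e%:C ^+ 2 * (1 - d%:C) <= 4 * K%:C * d%:C.
    apply: (@le_trans _ _ (e%:C ^+ 2 * \sum_i n i)).
      rewrite ler_pM2l; last by rewrite exprn_gt0// ltcR.
      rewrite lerBlDl -lerBlDr (le_trans _ (ltW HN))// real_ler_norm//.
      by rewrite rpredB// ger0_real// sumr_ge0.
    rewrite mulr_sumr; apply: (@le_trans _ _ (\sum_i \sum_(s <- F) q i s)).
      apply: ler_sum => i _.
      rewrite real_leNgt ?ger0_real ?mulr_ge0 ?sumr_ge0 ?exprn_ge0 ?(ltW eC0)//.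
      exact/negP.
    rewrite exchange_big/= big_seq.
    apply: (@le_trans _ _ (\sum_(s <- F | s \in F) 4 * d%:C)).
      exact: ler_sum.
    rewrite -big_seq big_const_seq count_predT iter_addr_0.
    by rewrite /K rmorph_nat mulrAC mulr_natr.
  have eqs : (4 * K%:C * d%:C = (4 * K * d)%:C) *
      (e%:C ^+ 2 * (1 - d%:C) = (e ^+ 2 * (1 - d))%:C).
    by split; rewrite ?(rmorphM, rmorphB, rmorphXn, rmorph1, rmorph_nat).
  by rewrite !eqs lecR leNgt dK.
have ni0 : 0 < n i.
  rewrite lt0r n_ge0 andbT; apply/eqP => n0; move: Hi; rewrite n0 mulr0.
  by apply/negP; rewrite -real_leNgt ?ger0_real ?sumr_ge0.
pose c := (sqrtC (n i))^-1.
have cc : c * c^* = (n i)^-1.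
  rewrite /c fmorphV /= (CrealP _); last by rewrite ger0_real// sqrtC_ge0 ltW.
  by rewrite -invfM -expr2 sqrtCK.
exists (c *: w i); split.
  by rewrite dotZl dotZr mulrA cc -/(n i) mulVf// gt_eqF.
move=> s sF; rewrite linearZ/= -scalerBr ltr_hilbert_norm ?ltcR//.
rewrite dotZl dotZr mulrA cc -/(q i s) mulrC ltr_pdivrMr//.
apply: le_lt_trans Hi; rewrite (big_fsetD1 s)//= lerDl.
exact: sumr_ge0.
Qed.

(** Multiplying [w] by the phase of [a = <v, w>] turns the inner product into [|a|] and leaves norms
    and displacements unchanged. Reality is what [reflection_swap] requires. *)
Lemma exists_almost_invariant_real (R : realType) (L : groupType)
    (rho : unitaryRep R L) (v : rep_space rho) :
  weakly_contained (trivial_rep R L) rho ->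
  forall (F : {fset L}) (e : R), 0 < e ->
  exists w : rep_space rho, [/\ inner _ w w = 1, inner _ v w \is Num.real &
    forall s, s \in F -> `|rho s w - w| < e%:C].
Proof.
move=> /exists_almost_invariant ex F e /(ex F)[w [w1 wF]].
pose a := inner _ v w.
have [a0|a0] := eqVneq a 0; first by exists w; split=> //; rewrite -/a a0.
have aa0 : `|a| != 0 by rewrite normr_eq0.
have cc : `|a / `|a| | = 1 by rewrite normrM normfV normr_id divff.
exists ((a / `|a|) *: w); split.
- by rewrite dotZl dotZr mulrA w1 mulr1 -normCK cc expr1n.
- rewrite dotZr -/a rmorphM fmorphV /= (CrealP (normr_real a)) mulrAC.
  by rewrite [_ * a]mulrC -normCK expr2 mulfK.
- by move=> s sF; rewrite linearZ/= -scalerBr normrZ cc mul1r wF.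
Qed.

(** The mean minus [w] is the mean of the [f s - w], and norms differ by at most the norm of the
    difference. *)
Lemma norm_mean_near1 (R : realType) (H : hilbertSpace R) (I : choiceType)
    (E : {fset I}) (f : I -> H) (w : H) (c : R[i]) : `|w| = 1 -> E != fset0 ->
  (forall s, s \in E -> `|f s - w| <= c) ->
  `|1 - `|#|` E|%:R^-1 *: \sum_(s <- E) f s| | <= c.
Proof.
move=> w1 E0 fw; have nz : (#|` E|%:R : R[i]) != 0 by rewrite pnatr_eq0 cardfs_eq0.
rewrite -{1}w1 (le_trans (ler_dist_dist _ _))//.
rewrite distrC; set a := (X in `|X|).
have -> : a = #|` E|%:R^-1 *: \sum_(s <- E) (f s - w).
  rewrite sumrB scalerBr big_const_seq count_predT iter_addr_0.
  by rewrite /a -[w *+ _]scaler_nat scalerA mulVf// scale1r.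
rewrite normrZ normfV normr_nat ler_pdivrMl ?lt0r ?nz ?ler0n//.
rewrite (le_trans (ler_norm_sum _ _ _))// mulr_natl big_seq.
rewrite -[leRHS]addr0 -iter_addr -count_predT -big_const_seq [leRHS]big_seq.
by rewrite ler_sum.
Qed.

(** Indices outside the range of [g] are sent to the default [x0], so [e] is total even for finite
    [T]. *)
Lemma enum_countable (T : choiceType) (x0 : T) : countable [set: T] ->
  exists (e : nat -> T) (g : T -> nat), cancel g e.
Proof.
move=> /countable_injP[g ginj].
exists (fun n => xget x0 [set x | g x = n]), g => x.
apply: ginj; rewrite ?inE//.
by apply: (@xgetPex _ x0 [set y | g y = g x]); exists x.
Qed.

Lemma flabby_embedding (R : realType) (L : groupType) :
  countable [set: L] -> ~ property_T R L ->
  exists (G : groupType) (iota : L -> G),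
    [/\ countable [set: G], injective iota,
        forall x y : L, iota (x * y)%g = (iota x * iota y)%g &
        flabby_pair R (range iota)].
Proof.
move=> cL /existsNP[rho /not_implyP[_ /not_implyP[wc noinv]]].
(* Only the unit norm matters here. This [v] is fixed before any sequence [F] is given. *)
have [v [v1 _]] := exists_almost_invariant wc fset0 ltr01.
have {}wc (F : {fset L}) : exists w : rep_space rho,
    [/\ inner _ w w = 1, inner _ v w \is Num.real &
    forall s, s \in F -> `|rho s w - w| < (#|` F|.+1%:R^-1)%:C].
  by apply: exists_almost_invariant_real wc _ _ _; rewrite invr_gt0.
have [w wP] := choice wc.
have [e [g gK]] := enum_countable 1%g cL.
pose H := rep_space rho.
(* Finite subsets of [L] are coded by lists of indices, which keeps the alphabet countable. The
   first coordinate makes [iota] injective even if [rho] is not faithful. *)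
pose gen (a : nat + seq nat) : L * unitary H :=
  match a with
  | inl n => (e n, unitary_of_rep rho (e n))
  | inr s => (1%g, reflection_unitary (v - w [fset x in map e s]))
  end.
have [K [i [cK iinj iM i1 igen]]] := countable_subgroup gen.
have /choice[iota iotaE] s : exists k, i k = (s, unitary_of_rep rho s).
  by have [k ik] := igen (inl (g s)); exists k; rewrite ik /= gK.
have /choice[t tE] (E : {fset L}) :
    exists k, i k = (1%g, reflection_unitary (v - w E)).
  have [k ik] := igen (inr (map g E)); exists k; rewrite ik /= -map_comp.
  rewrite (_ : [fset x in _] = E)//; apply/fsetP => x.
  by rewrite (eq_map gK) map_id !inE.
exists K, iota; split => //.
- by move=> x y xy; have := iotaE x; rewrite xy iotaE => -[].
- by move=> x y; apply: iinj; rewrite iM !iotaE unitary_of_repM.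
pose f k := (i k).2.
have f1 : f 1%g = 1%g by rewrite /f i1.
have fM : {morph f : x y / (x * y)%g} by move=> x y; rewrite /f iM.
exists (unitary_rep f1 fM); split => [u uinv|F FL Foo].
  apply: contrapT => u0; apply: noinv; exists u; split => // s _.
  have := uinv (iota s) (imageT _ _).
  by rewrite /= /f iotaE.
(* [E n] is the copy of [F n] in [L]. The first projection is injective on [F n], whose elements map
   to pairs [(s, rho s)]. *)
pose E n := [fset (i x).1 | x in F n].
have EP n x : x \in F n -> i x = ((i x).1, unitary_of_rep rho (i x).1).
  by move=> /FL[s _ <-]; rewrite iotaE.
have Einj n : {in F n &, injective (fun x => (i x).1)}.
  by move=> x y xF yF xy; apply: iinj; rewrite (EP n x)// (EP n y)// xy.
have cE n : #|` E n| = #|` F n| by rewrite card_in_imfset//; exact: Einj.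
exists (fun n => t (E n)), v; split.
  by apply/eqP; rewrite -(@pexpr_eq1 _ _ 2)// inner_norm v1.
have sumE n : \sum_(s <- F n) unitary_rep f1 fM (s * t (E n))%g v =
    \sum_(s <- E n) rho s (w (E n)).
  rewrite /E big_imfset/=; last exact: Einj.
  rewrite big_seq [RHS]big_seq; apply: eq_bigr => s sF.
  rewrite /f iM tE (EP n s)//=.
  have [w1 wr _] := wP (E n).
  by rewrite reflection_swap// v1 w1.
apply/cvgrPdist_lt => eps eps0.
have epsE : eps = (complex.Re eps)%:C by rewrite RRe_real// gtr0_real.
have eps0' : 0 < complex.Re eps by rewrite -ltcR -epsE.
(* The bound exceeds [1/eps], making [1/(|E n|+1)] less than [eps]; the successor ensures that [F n]
   is nonempty. *)
move/cvgnyPge: Foo => /(_ (Num.bound (complex.Re eps)^-1).+1).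
apply: filterS => n Fn; rewrite sumE -cE.
have [w1 wr wn] := wP (E n).
apply: (@le_lt_trans _ _ (#|` E n|.+1%:R^-1)%:C).
  apply: (@norm_mean_near1 _ _ _ _ _ (w (E n))).
  - by apply/eqP; rewrite -(@pexpr_eq1 _ _ 2)// inner_norm w1.
  - by rewrite -cardfs_gt0 cE (leq_trans _ Fn).
  - by move=> s /wn/ltW.
rewrite epsE ltcR invf_plt ?posrE// (lt_trans (archi_boundP _))//.
  by rewrite invr_ge0 ltW.
by rewrite ltr_nat ltnS cE ltnW.
Qed.

(** * The Hilbert space l^2 *)

#[local] Existing Instance totally_filter.

Section Sums.
Variables (R : realType) (I : choiceType).
Implicit Types (h : I -> R[i]) (l : R[i]).

(* The directed set of finite subsets of I makes the sum unconditional, hence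
   invariant under permutations of I. *)
Definition has_sum h l :=
  (fun A : {fset I} => \sum_(i <- A) h i : (R[i])^o) @ totally --> (l : (R[i])^o).

Lemma has_sum_unique h l l' : has_sum h l -> has_sum h l' -> l = l'.
Proof. exact: (@norm_cvg_unique _ (R[i])^o). Qed.

Lemma has_sumD h h' l l' : has_sum h l -> has_sum h' l' ->
  has_sum (fun i => h i + h' i) (l + l').
Proof.
move=> hl hl'; rewrite /has_sum; under eq_fun do rewrite big_split.
exact: (@cvgD _ (R[i])^o).
Qed.

Lemma has_sumZ a h l : has_sum h l -> has_sum (fun i => a * h i) (a * l).
Proof.
move=> hl; rewrite /has_sum; under eq_fun do rewrite -mulr_sumr.
exact: (@cvgZl_tmp _ (R[i])^o).
Qed.

Lemma has_sumP h l : has_sum h l <-> forall e : R[i], 0 < e ->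
  exists A : {fset I}, forall B : {fset I}, A `<=` B -> `|l - \sum_(i <- B) h i| < e.
Proof.
rewrite /has_sum; split.
  by move=> /cvgrPdist_lt H e /H [A _ AB]; exists A.
by move=> H; apply/cvgrPdist_lt => e /H[A AB]; exists A.
Qed.

Arguments has_sumZ a {h l}.

Lemma has_sum_conj h l : has_sum h l -> has_sum (fun i => (h i)^* ) l^*.
Proof.
move=> /has_sumP H; apply/has_sumP => e /H[A AB]; exists A => B /AB.
by rewrite -rmorph_sum -rmorphB norm_conjC.
Qed.

Lemma has_sum_finite h (A : {fset I}) : (forall i, i \notin A -> h i = 0) ->
  has_sum h (\sum_(i <- A) h i).
Proof.
move=> h0; apply/has_sumP => e e0; exists A => B AB.
by rewrite (big_fset_incl _ AB) ?subrr ?normr0// => x _ /h0.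
Qed.

Lemma has_sum_reindex (p q : I -> I) h l : cancel p q -> cancel q p ->
  has_sum h l -> has_sum (h \o p) l.
Proof.
move=> pK qK /has_sumP H; apply/has_sumP => e /H[A AB].
exists [fset q x | x in A] => B qB.
have -> : \sum_(i <- B) (h \o p) i = \sum_(j <- [fset p x | x in B]) h j.
  by rewrite big_imfset//= => x y _ _; exact: can_inj pK _ _.
apply: AB; apply/fsubsetP => x xA; apply/imfsetP; exists (q x); last by rewrite qK.
by apply: (fsubsetP qB); apply/imfsetP; exists x.
Qed.

Lemma ler_sum_fset h (A B : {fset I}) : (forall i, 0 <= h i) -> A `<=` B ->
  \sum_(i <- A) h i <= \sum_(i <- B) h i.
Proof.
move=> h0 AB; rewrite [leRHS](big_fsetID _ (mem A))/=.
rewrite (_ : [fset x in B | x \in A] = A); first by rewrite lerDl sumr_ge0.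
apply/fsetP => x; rewrite !inE /=; apply/andP/idP => [[]//|xA].
by split => //; exact: (fsubsetP AB).
Qed.

(** The sum is the supremum of the finite partial sums, taken in [R] through real parts. *)
Lemma has_sum_ge0 h M : (forall i, 0 <= h i) ->
  (forall A : {fset I}, \sum_(i <- A) h i <= M) ->
  exists l, [/\ has_sum h l, forall A : {fset I}, \sum_(i <- A) h i <= l & l <= M].
Proof.
move=> h0 hM.
have M0 : 0 <= M by have := hM fset0; rewrite big_seq_fset0.
pose S (A : {fset I}) : R := complex.Re (\sum_(i <- A) h i).
have SE (A : {fset I}) : \sum_(i <- A) h i = (S A)%:C.
  by rewrite /S RRe_real// ger0_real// sumr_ge0.
have ME : M = (complex.Re M)%:C by rewrite RRe_real// ger0_real.
have SM A : S A <= complex.Re M by have := hM A; rewrite SE ME lecR.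
have S0 : range S !=set0 by exists (S fset0), fset0.
have Sub : has_ubound (range S) by exists (complex.Re M) => _ [A _ <-].
have Ssup A : S A <= sup (range S) by apply: ub_le_sup => //; exists A.
exists (sup (range S))%:C; split.
- apply/has_sumP => e e0.
  have eE : e = (complex.Re e)%:C by rewrite RRe_real// gtr0_real.
  have e0' : 0 < complex.Re e by rewrite -ltcR -eE.
  have [_ [A _ <-] SA] := @sup_adherent _ (range S) _ e0' (conj S0 Sub).
  exists A => B AB.
  have SAB : S A <= S B by rewrite -lecR -!SE ler_sum_fset.
  rewrite SE -rmorphB ger0_norm; last by rewrite lecR subr_ge0.
  by rewrite eE ltcR ltrBlDl -ltrBlDr (lt_le_trans SA).
- by move=> A; rewrite SE lecR.
- by rewrite ME lecR; apply: ge_sup => // _ [A _ <-].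
Qed.

End Sums.
Arguments has_sumZ {R I} a {h l}.

Section Ell2.
Variables (R : realType) (I : choiceType).
Implicit Types (f g : I -> (R[i])^o).

Lemma sqr_normD_le (x y : R[i]) : `|x + y| ^+ 2 <= 2 * `|x| ^+ 2 + 2 * `|y| ^+ 2.
Proof.
apply: (@le_trans _ _ ((`|x| + `|y|) ^+ 2)).
  by rewrite lerXn2r// ?nnegrE ?addr_ge0// ler_normD.
rewrite -subr_ge0 (_ : _ - _ = (`|x| - `|y|) ^+ 2); last by ring.
by rewrite real_exprn_even_ge0// rpredB.
Qed.

(** The empty [A] gives [0 <= M], so the bound is real although typed in [R[i]]. *)
Definition sqsummable : pred (I -> (R[i])^o) := fun f =>
  `[< exists M : R[i], forall A : {fset I}, \sum_(i <- A) `|f i : R[i]| ^+ 2 <= M >].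

Lemma sqsummable_closed : submod_closed sqsummable.
Proof.
split.
  by apply/asboolP; exists 0 => A; rewrite big1// => i _; rewrite normr0 expr0n.
move=> a f g /asboolP[M fM] /asboolP[N gN]; apply/asboolP.
exists (2 * (`|a| ^+ 2 * M) + 2 * N) => A.
apply: (@le_trans _ _ (\sum_(i <- A)
    (2 * (`|a| ^+ 2 * `|f i : R[i]| ^+ 2) + 2 * `|g i : R[i]| ^+ 2))).
  apply: ler_sum => i _; rewrite -exprMn -normrM.
  exact: sqr_normD_le.
by rewrite big_split/= -!mulr_sumr lerD// ler_pM2l// ler_wpM2l// exprn_ge0.
Qed.

Definition ell2 := {f : I -> (R[i])^o | sqsummable f}.

HB.instance Definition _ := SubChoice.on ell2.
HB.instance Definition _ :=
  GRing.SubChoice_isSubLmodule.Build R[i] (I -> (R[i])^o) sqsummable ell2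
    sqsummable_closed.

Definition entry (u : ell2) (i : I) : R[i] := (val u : I -> (R[i])^o) i.

Lemma entryP (u v : ell2) : entry u =1 entry v -> u = v.
Proof. by move=> uv; apply: val_inj; exact/funext. Qed.

Lemma entryZD a (u v : ell2) i : entry (a *: u + v) i = a * entry u i + entry v i.
Proof. by []. Qed.

Lemma entryB (u v : ell2) i : entry (u - v) i = entry u i - entry v i.
Proof. by []. Qed.

Lemma entryD (u v : ell2) i : entry (u + v) i = entry u i + entry v i.
Proof. by []. Qed.

Lemma entryZ a (v : ell2) i : entry (a *: v) i = a * entry v i.
Proof. by []. Qed.

Lemma exists_ell2 (f : I -> R[i]) (M : R[i]) :
  (forall A : {fset I}, \sum_(i <- A) `|f i| ^+ 2 <= M) ->
  exists u : ell2, entry u = f.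
Proof.
move=> fM; have fs : sqsummable f by apply/asboolP; exists M.
by exists (exist _ (f : I -> (R[i])^o) fs).
Qed.

Lemma exists_finitely_supported (A : {fset I}) (f : I -> R[i]) :
  exists u : ell2, forall x, entry u x = if x \in A then f x else 0.
Proof.
pose f0 x := if x \in A then f x else 0.
have [|u uE] := @exists_ell2 f0 (\sum_(x <- A) `|f x| ^+ 2).
  (* Enlarge [B] to contain [A], then drop the terms outside [A], which vanish. *)
  move=> B; apply: (@le_trans _ _ (\sum_(x <- A `|` B) `|f0 x| ^+ 2)).
    by apply: ler_sum_fset => [x|]; rewrite ?exprn_ge0// fsubsetUr.
  rewrite -(big_fset_incl _ (fsubsetUl A B)) => [|x _ /negbTE xA]; last first.
    by rewrite /f0 xA normr0 expr0n.
  by rewrite big_seq [leRHS]big_seq; apply: ler_sum => x xA; rewrite /f0 xA.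
by exists u => x; rewrite uE.
Qed.

Lemma has_sum_sqr (u : ell2) : exists l : R[i],
  has_sum (fun i => `|entry u i| ^+ 2) l /\
  forall A : {fset I}, \sum_(i <- A) `|entry u i| ^+ 2 <= l.
Proof.
have [M uM] := asboolP _ (valP u).
have [l [? ? _]] := has_sum_ge0 (fun i => exprn_ge0 2 (normr_ge0 (entry u i))) uM.
by exists l.
Qed.

(* Reduces the convergence of the inner product to that of sums of squares. *)
Lemma mul_conj_polarization (x y : R[i]) : x * y^* =
  4^-1 * (`|x + y| ^+ 2 + -1 * `|x - y| ^+ 2
         + ('i * `|x + 'i * y| ^+ 2 + - 'i * `|x - 'i * y| ^+ 2)).
Proof.
rewrite !normCK !(rmorphD, rmorphN, rmorphM)/= conjCi.
have ii : 'i * 'i = -1 :> R[i] by rewrite -expr2 sqrCi.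
have n4 : (4 : R[i]) != 0 by rewrite pnatr_eq0.
apply: (mulfI n4); rewrite [RHS]mulrA divff// mul1r.
transitivity (4 * (x * y^*) + ('i * 'i + 1) * (2 * x^* * y - 2 * x * y^*)); last by ring.
by rewrite ii addNr mul0r addr0.
Qed.

Definition ell2_inner (u v : ell2) : R[i] :=
  lim ((fun A : {fset I} => \sum_(i <- A) (entry u i * (entry v i)^* ) : (R[i])^o)
    @ totally).

(** Shows that the [lim] in [ell2_inner] exists: by termwise polarization the series combines the
    sums of squares of [u + v], [u - v], [u + 'i *: v] and [u - 'i *: v]. *)
Lemma ell2_inner_has_sum u v :
  has_sum (fun i => entry u i * (entry v i)^* ) (ell2_inner u v).
Proof.
have [a [ha _]] := has_sum_sqr (u + v).
have [b [hb _]] := has_sum_sqr (u - v).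
have [c [hc _]] := has_sum_sqr (u + 'i *: v).
have [d [hd _]] := has_sum_sqr (u - 'i *: v).
have := has_sumZ 4^-1 (has_sumD (has_sumD ha (has_sumZ (-1) hb))
  (has_sumD (has_sumZ 'i hc) (has_sumZ (- 'i) hd))).
under [X in has_sum X _]eq_fun do
  rewrite entryD !entryB entryD !entryZ -mul_conj_polarization.
by move=> h; apply/cvg_ex; eexists; exact: h.
Qed.

Arguments ell2_inner_has_sum : clear implicits.

Lemma ell2_inner_eq u v l :
  has_sum (fun i => entry u i * (entry v i)^* ) l -> ell2_inner u v = l.
Proof. exact/has_sum_unique/ell2_inner_has_sum. Qed.

Lemma ell2_innerC u v : ell2_inner u v = (ell2_inner v u)^*.
Proof.
apply: ell2_inner_eq; have := has_sum_conj (ell2_inner_has_sum v u).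
by under [X in has_sum X _]eq_fun do rewrite rmorphM /= conjCK mulrC.
Qed.

Lemma ell2_innerPl a u v w :
  ell2_inner (a *: u + v) w = a * ell2_inner u w + ell2_inner v w.
Proof.
apply: ell2_inner_eq.
have := has_sumD (has_sumZ a (ell2_inner_has_sum u w)) (ell2_inner_has_sum v w).
by under [X in has_sum X _]eq_fun do rewrite mulrA -mulrDl -entryZD.
Qed.

Lemma ell2_inner_bilinear :
  bilinear_for *%R (@Num.conj R[i] \; *%R) ell2_inner.
Proof.
split=> w a u v; first exact: ell2_innerPl.
rewrite /= ell2_innerC ell2_innerPl rmorphD rmorphM.
by rewrite (ell2_innerC w u) (ell2_innerC w v).
Qed.

HB.instance Definition _ := @bilinear_isBilinear.Build R[i] ell2 ell2 R[i]
  *%R (@Num.conj R[i] \; *%R) ell2_inner ell2_inner_bilinear.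

Lemma ell2_inner_hermitian u v :
  ell2_inner u v = (-1) ^+ false * Num.conj (ell2_inner v u).
Proof. by rewrite expr0 mul1r ell2_innerC. Qed.

HB.instance Definition _ := @isHermitianSesquilinear.Build R[i]
  ell2 false (@Num.conj R[i]) ell2_inner ell2_inner_hermitian.

Lemma ell2_inner_sum_le u (A : {fset I}) :
  \sum_(i <- A) `|entry u i| ^+ 2 <= ell2_inner u u.
Proof.
have [l [hl lA]] := has_sum_sqr u; rewrite (@ell2_inner_eq _ _ l)//.
by under [X in has_sum X _]eq_fun do rewrite -normCK.
Qed.

Lemma ell2_inner_le u M : (forall A : {fset I}, \sum_(i <- A) `|entry u i| ^+ 2 <= M) ->
  ell2_inner u u <= M.
Proof.
move=> uM.
have [l [hl _ lM]] := has_sum_ge0 (fun i => exprn_ge0 2 (normr_ge0 (entry u i))) uM.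
rewrite (@ell2_inner_eq _ _ l)//.
by under [X in has_sum X _]eq_fun do rewrite -normCK.
Qed.

Lemma ell2_inner_gt0 u : u != 0 -> 0 < ell2_inner u u.
Proof.
move=> u0; have [i ui] : exists i, entry u i != 0.
  apply: contrapT => /forallNP u00; case/eqP: u0; apply: entryP => i.
  by apply/eqP/negP => ui; apply: (u00 i); apply/negP.
apply: lt_le_trans (ell2_inner_sum_le u [fset i]).
by rewrite big_seq_fset1 exprn_gt0// normr_gt0.
Qed.

HB.instance Definition _ := @isDotProduct.Build R[i] ell2 ell2_inner ell2_inner_gt0.

End Ell2.
Arguments ell2_inner_has_sum {R I} u v.

(** * Norm and completeness of l^2 *)

Section Ell2Hilbert.
Variables (R : realType) (I : choiceType).
Local Notation ell2 := (ell2 R I).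
Implicit Types u v : ell2.

Definition ell2_norm u : R[i] := sqrtC (ell2_inner u u).

Lemma ell2_normD u v : ell2_norm (u + v) <= ell2_norm u + ell2_norm v.
Proof. exact: sqrt_dnormD_le. Qed.

Lemma ell2_normZ (a : R[i]) u : ell2_norm (a *: u) = `|a| * ell2_norm u.
Proof.
rewrite /ell2_norm dnormZ rootCMl ?exprn_ge0//.
by rewrite sqrCK.
Qed.

Lemma ell2_norm_eq0 u : ell2_norm u = 0 -> u = 0.
Proof. by move/eqP; rewrite sqrtC_eq0 dnorm_eq0 => /eqP. Qed.

HB.instance Definition _ :=
  Lmodule_isNormed.Build R[i] ell2 ell2_normD ell2_normZ ell2_norm_eq0.

Lemma ell2_inner_norm u : `|u| ^+ 2 = ell2_inner u u.
Proof. exact: sqrtCK. Qed.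

Lemma ell2_norm_le u M : 0 <= M ->
  (forall A : {fset I}, \sum_(i <- A) `|entry u i| ^+ 2 <= M ^+ 2) -> `|u| <= M.
Proof.
by move=> M0 /ell2_inner_le; rewrite -ell2_inner_norm ler_sqr// nnegrE.
Qed.

Lemma ell2_sum_le_norm u (A : {fset I}) :
  \sum_(i <- A) `|entry u i| ^+ 2 <= `|u| ^+ 2.
Proof. by rewrite ell2_inner_norm; exact: ell2_inner_sum_le. Qed.

Lemma entry_le_norm u i : `|entry u i| <= `|u|.
Proof.
rewrite -ler_sqr ?nnegrE//.
by have := ell2_sum_le_norm u [fset i]; rewrite big_seq_fset1.
Qed.

(** Entries are dominated by the norm, so they converge to some [h]; distances to [h] are then
    estimated on finite sets of indices, uniformly in the set. *)
Lemma ell2_complete (F : set_system ell2) : ProperFilter F -> cauchy F -> cvg F.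
Proof.
move=> FF /cauchyP Fc.
have /choice[h hF] i : exists l : R[i], forall e : R[i], 0 < e ->
    F (fun u => `|l - entry u i| < e).
  have /cvg_ex[l] : cvg ((fun u => entry u i : (R[i])^o) @ F).
    apply: complex_complete; apply/cauchyP => e e0.
    have [u Fu] := Fc _ e0; exists (entry u i : (R[i])^o).
    change (F (fun v => `|entry u i - entry v i| < e)).
    apply: filterS Fu => v; rewrite -ball_normE/= -entryB.
    exact: le_lt_trans (entry_le_norm _ _).
  by move=> /cvgrPdist_lt hl; exists l.
have key (u : ell2) e : 0 < e -> F (ball u e) ->
    forall A : {fset I}, \sum_(i <- A) `|h i - entry u i| ^+ 2 <= (2 * e) ^+ 2.
  (* Chosen so that [|A| * d ^+ 2 <= e ^+ 2]: some [v] in the [e]-ball of [u] is within [d] of [h]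
     at each index of [A]. *)
  move=> e0 Fu A; pose d := e / #|` A|.+1%:R.
  have d0 : 0 < d by rewrite divr_gt0.
  have FA : F (\bigcap_(i in [set` A]) [set v | `|h i - entry v i| < d]).
    by apply: filter_bigI => i _; exact: hF.
  have [v [uv vA]] := filter_ex (filterI Fu FA).
  apply: (@le_trans _ _ (\sum_(i <- A) (2 * d ^+ 2 + 2 * `|entry (v - u) i| ^+ 2))).
    rewrite big_seq [leRHS]big_seq; apply: ler_sum => i iA.
    rewrite -(subrKA (entry v i)) entryB (le_trans (sqr_normD_le _ _))//.
    by rewrite lerD2r ler_pM2l// lerXn2r// ?nnegrE ?(ltW d0)// ltW//; exact: vA.
  rewrite big_split/= -[X in X + _]mulr_sumr -[X in _ + X]mulr_sumr.
  rewrite big_const_seq count_predT iter_addr_0.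
  have -> : (2 * e) ^+ 2 = 2 * e ^+ 2 + 2 * e ^+ 2 by ring.
  rewrite lerD//.
    rewrite ler_pM2l// -[leLHS]mulr_natr /d expr_div_n -mulrA.
    rewrite ler_piMr ?exprn_ge0 ?(ltW e0)//.
    rewrite ler_pdivrMl ?exprn_gt0// mulr1 -natrX ler_nat.
    by rewrite (leq_trans (leqnSn _))// leq_pmulr.
  rewrite ler_pM2l// (le_trans (ell2_sum_le_norm _ _))//.
  rewrite lerXn2r// ?nnegrE ?(ltW e0)// ltW//.
  by move: uv; rewrite -ball_normE/= distrC.
have [u0 Fu0] := Fc _ ltr01.
(* [k] is [h - u0], square summable by [key]; this puts [h] itself in l^2. *)
have [k kE] := exists_ell2 (key _ _ ltr01 Fu0).
pose l := u0 + k.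
have lE i : entry l i = h i by rewrite entryD kE addrC subrK.
apply/cvg_ex; exists l; apply/cvgrPdist_lt => e e0.
(* [key] costs a factor 2, so the total is [2 * (e / 4) + e / 4], below [e]. *)
have e4 : 0 < e / 4 by rewrite divr_gt0.
have [u Fu] := Fc _ e4.
apply: (filterS _ Fu) => v; rewrite -ball_normE/= => uv.
rewrite -(subrKA u) (le_lt_trans (ler_normD _ _))//.
have lu : `|l - u| <= 2 * (e / 4).
  apply: ell2_norm_le; first by rewrite mulr_ge0// ltW.
  by move=> A; under eq_bigr do rewrite entryB lE; exact: key.
rewrite (lt_le_trans (ler_ltD lu uv))// -subr_ge0.
have -> : e - (2 * (e / 4) + e / 4) = e / 4 by field.
exact: ltW.
Qed.

Definition ell2_completeNormedMod : completeNormedModType R[i] :=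
  HB.pack_for (completeNormedModType R[i]) ell2
    (Uniform_isComplete.Build ell2 ell2_complete).

Definition ell2_hilbertSpace : hilbertSpace R :=
  @HilbertSpace R ell2_completeNormedMod (@ell2_inner R I) ell2_inner_norm.

End Ell2Hilbert.

(** * Separability of l^2 *)

Definition rat_complex (R : realType) (c : rat * rat) : R[i] :=
  ratr c.1 +i* ratr c.2.

Lemma rat_complex_dense (R : realType) (z : R[i]) (d : R) : 0 < d ->
  exists c, `|z - rat_complex R c| < d%:C.
Proof.
move=> d0; have d2 : 0 < d / 2 by rewrite divr_gt0.
have approx (x : R) : exists p : rat, `|x - ratr p| < d / 2.
  have : x - d / 2 < x + d / 2 by rewrite ltrD2l gtrN.
  move=> /rat_in_itvoo[p]; rewrite in_itv/= => /andP[xp px].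
  by exists p; rewrite ltr_norml; apply/andP; split; lra.
have [p zp] := approx (complex.Re z); have [q zq] := approx (complex.Im z).
exists (p, q); apply: ltcR_normD; first by rewrite complex_ReB.
by rewrite complex_ImB.
Qed.

(** The countable dense set consists of the finite combinations of basis vectors with coefficients
    in [Q + iQ]. *)
Lemma ell2_separable (R : realType) (I : choiceType) (i0 : I) :
  countable [set: I] -> separable (ell2_hilbertSpace R I).
Proof.
move=> /(enum_countable i0)[e [g gK]].
have /choice[delta deltaE] i : exists u : ell2 R I,
    forall x, entry u x = if x \in [fset i] then 1 else 0.
  exact: exists_finitely_supported.
pose f (w : seq (nat * (rat * rat))) : ell2 R I :=
  \sum_(a <- w) rat_complex R a.2 *: delta (e a.1).
exists (range f); split; first exact: sub_countable (card_image_le _ _) _.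
move=> O [u Ou] oO.
have /nbhs_ballP[r /= r0 rO] : nbhs (u : ell2 R I) O by exact: open_nbhs_nbhs.
suff [w uw] : exists w, `|u - f w| < r.
  by exists (f w); split; [apply: rO; rewrite -ball_normE | exists w].
have rE : r = (complex.Re r)%:C by rewrite RRe_real// gtr0_real.
have r0' : 0 < complex.Re r by rewrite -ltcR -rE.
pose t := complex.Re r / 2.
have t0 : 0 < t by rewrite divr_gt0.
have t2 : 0 < (t ^+ 2 / 2)%:C by rewrite ltcR divr_gt0// exprn_gt0.
(* [A] carries the squared norm of [u] up to [t ^+ 2 / 2]; the other half of [t ^+ 2] is left for
   rounding the entries on [A]. *)
have [A uA] := (has_sumP _ _).1 (ell2_inner_has_sum u u) _ t2.
pose d := t / (#|` A| + 2)%:R.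
have d0 : 0 < d by rewrite divr_gt0// ltr0n addn2.
have dA : #|` A|%:R * d ^+ 2 <= t ^+ 2 / 2.
  rewrite /d expr_div_n mulrCA ler_pM2l ?exprn_gt0//.
  rewrite ler_pdivrMr ?exprn_gt0 ?ltr0n ?addn2//.
  rewrite -[X in _ <= _ * X%:R ^+ 2]addn2 natrD.
  have := sqr_ge0 (#|` A|%:R : R); have := ler0n R #|` A|.
  by move: (#|` A|%:R : R) => x; nra.
have /choice[c cE] i := rat_complex_dense (entry u i) d0.
exists [seq (g i, c i) | i <- A]; set v := f _.
have entry_sum (s : seq I) (G : I -> ell2 R I) x :
    entry (\sum_(i <- s) G i) x = \sum_(i <- s) entry (G i) x.
  by elim: s => [|i s IH]; rewrite ?big_nil ?big_cons// entryD IH.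
have vE x : entry v x = if x \in A then rat_complex R (c x) else 0.
  rewrite /v /f big_map entry_sum.
  under eq_bigr do rewrite entryZ deltaE /= gK inE.
  have [xA|xA] := boolP (x \in A).
    rewrite (big_fsetD1 x)//= eqxx mulr1 big1_fset ?addr0// => i.
    by rewrite !inE eq_sym => /andP[/negbTE->] _ _; rewrite mulr0.
  rewrite big1_fset// => i iA _; case: eqP => [xi|]; last by rewrite mulr0.
  by rewrite xi iA in xA.
apply: (@le_lt_trans _ _ t%:C); last first.
  by rewrite rE ltcR ltr_pdivrMr// ltr_pMr// ltr1n.
apply: ell2_norm_le => [|B]; first by rewrite lecR ltW.
apply: (@le_trans _ _ (\sum_(x <- A `|` B) `|entry (u - v) x| ^+ 2)).
  by apply: ler_sum_fset => [x|]; rewrite ?exprn_ge0// fsubsetUr.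
(* Since [v] vanishes off [A], only the terms on [A] change. Regrouping leaves the rounding error on
   [A] plus the tail of [u]. *)
have -> : \sum_(x <- A `|` B) `|entry (u - v) x| ^+ 2 =
    \sum_(x <- A `|` B) `|entry u x| ^+ 2 +
    \sum_(x <- A) (`|entry (u - v) x| ^+ 2 - `|entry u x| ^+ 2).
  rewrite (big_fset_incl _ (fsubsetUl A B)) => [|x _ /negbTE xA].
    by rewrite -big_split/=; apply: eq_bigr => x _; rewrite addrC subrK.
  by rewrite entryB vE xA subr0 subrr.
rewrite sumrB addrCA.
have -> : t%:C ^+ 2 = (t ^+ 2 / 2)%:C + (t ^+ 2 / 2)%:C.
  by rewrite -rmorphD -rmorphXn -splitr.
apply: lerD.
  apply: (@le_trans _ _ (\sum_(x <- A) (d ^+ 2)%:C)).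
    rewrite big_seq [leRHS]big_seq; apply: ler_sum => x xA.
    have dC : 0 <= d%:C by rewrite lecR ltW.
    rewrite entryB vE xA rmorphXn lerXn2r//.
    exact/ltW/cE.
  rewrite big_const_seq count_predT iter_addr_0 -[leLHS]mulr_natl.
  by rewrite -(rmorph_nat (real_complex R)) -rmorphM lecR.
apply: (@le_trans _ _ (ell2_inner u u - \sum_(x <- A) `|entry u x| ^+ 2)).
  by rewrite lerD2r ell2_inner_sum_le.
under eq_bigr do rewrite normCK.
apply/ltW/(le_lt_trans _ (uA _ (fsubset_refl A))).
apply: real_ler_norm; rewrite rpredB// ger0_real ?dnorm_ge0//.
by apply: sumr_ge0 => x _; rewrite -normCK exprn_ge0.
Qed.

(** * The regular representation *)

Section RegularRep.
Variables (R : realType) (L : groupType).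
Local Notation ell2 := (ell2 R L).
Implicit Types (u v : ell2) (s t : L).

Lemma translate_proof s u :
  sqsummable (fun x => entry u (s^-1 * x)%g : (R[i])^o).
Proof.
apply/asboolP; exists (`|u| ^+ 2) => A.
have := ell2_sum_le_norm u [fset (s^-1 * x)%g | x in A].
by rewrite big_imfset//= => x y _ _; exact: mulgI.
Qed.

Definition translate s u : ell2 := exist (@sqsummable R L) _ (translate_proof s u).

Lemma entry_translate s u x : entry (translate s u) x = entry u (s^-1 * x)%g.
Proof. by []. Qed.

Lemma translate_linear s : linear (translate s).
Proof. by move=> a u v; exact: entryP. Qed.

HB.instance Definition _ s :=
  GRing.isLinear.Build R[i] ell2 ell2 _ (translate s) (translate_linear s).

(** Translation permutes the indices, and unconditional sums are invariant under permutations. *)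
Lemma translate_inner s u v :
  ell2_inner (translate s u) (translate s v) = ell2_inner u v.
Proof.
apply: ell2_inner_eq.
exact (has_sum_reindex (mulVKg s) (mulKg s) (ell2_inner_has_sum u v)).
Qed.

Lemma translate1 u : translate 1%g u = u.
Proof. by apply: entryP => x; rewrite entry_translate invg1 mul1g. Qed.

Lemma translateM s t u : translate (s * t)%g u = translate s (translate t u).
Proof. by apply: entryP => x; rewrite !entry_translate invgM mulgA. Qed.

Definition regular_rep : unitaryRep R L :=
  @UnitaryRep R L (ell2_hilbertSpace R L)
    (fun s => translate s : {linear ell2 -> ell2})
    translate1 translateM translate_inner.

Lemma regular_rep_invariant_eq0 (u : rep_space regular_rep) :
  infinite_set [set: L] -> invariant_vector [set: L] u -> u = 0.
Proof.
move=> Linf uinv; pose c := entry u 1%g.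
(* Evaluate at [1] the invariance under [x^-1]. *)
have uc x : entry u x = c.
  have /(congr1 (fun w : ell2 => entry w 1%g)) := uinv x^-1%g I.
  by rewrite /= entry_translate invgK mulg1.
have [c0|c0] := eqVneq c 0; first by apply: entryP => x; rewrite uc c0.
have c2 : 0 < `|c| ^+ 2 by rewrite exprn_gt0// normr_gt0.
pose a : R := complex.Re (`|u : ell2| ^+ 2 / `|c| ^+ 2).
have aE : `|u : ell2| ^+ 2 / `|c| ^+ 2 = a%:C.
  by rewrite /a RRe_real// ger0_real// divr_ge0 ?exprn_ge0.
have a0 : 0 <= a by rewrite -lecR -aE divr_ge0 ?exprn_ge0.
(* [B] has more than [a] elements, so the sum of [|c| ^+ 2] over [B] would exceed the squared norm
   of [u]. *)
have [B _ cB] := infinite_set_fset (Num.bound a) Linf.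
have := ell2_sum_le_norm (u : ell2) B.
rewrite (eq_bigr (fun=> `|c| ^+ 2)); last by move=> x _; rewrite uc.
rewrite big_const_seq count_predT iter_addr_0 -[leLHS]mulr_natl -ler_pdivlMr// aE.
rewrite -(rmorph_nat (real_complex R)) lecR leNgt (lt_le_trans (archi_boundP a0))//.
by rewrite ler_nat.
Qed.

(** One vector suffices: the indicator of a Folner set [S] times [v / sqrt |S|]. Its coefficient at
    [s] is [|v|^2] times the proportion of [S] lying in [sS]. *)
Lemma regular_rep_weakly_contains_trivial :
  amenable L -> weakly_contained (trivial_rep R L) regular_rep.
Proof.
(* The added 1 keeps [a] positive when [v = 0], so that [eps / a] can bound the rational Folner
   tolerance. *)
move=> aL v F eps eps0; pose a : R := complex.Re (`|v : R[i]| ^+ 2) + 1.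
have aE : `|v : R[i]| ^+ 2 < a%:C.
  rewrite -[ltLHS]RRe_real ?ger0_real ?exprn_ge0// ltcR ltrDl//.
have a0 : 0 < a by rewrite -ltcR; apply: le_lt_trans aE; rewrite exprn_ge0.
have [q /andP[q0 qeps]] : exists q : rat, (0 < q) && (ratr q < eps / a).
  have [q] := rat_in_itvoo (divr_gt0 eps0 a0).
  by rewrite in_itv/= => /andP[q0 qe]; exists q; rewrite qe -(ltr0q R) q0.
have [S [S0 SF]] := aL F q q0.
have cS : 0 < #|` S|%:R :> R[i] by rewrite ltr0n cardfs_gt0.
pose c := (v : R[i]) / sqrtC #|` S|%:R.
have c2 : c * c^* = `|v : R[i]| ^+ 2 / #|` S|%:R.
  rewrite -normCK /c normrM exprMn normfV exprVn.
  by rewrite (ger0_norm (_ : 0 <= sqrtC _)) ?sqrtC_ge0 ?sqrtCK// ltW.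
have [w wE] := exists_finitely_supported S (fun=> c).
exists 1%N, (fun=> w) => s sF; rewrite big_ord1.
have -> : inner (rep_space regular_rep) w (regular_rep s w) =
    \sum_(x <- S) (if (s^-1 * x)%g \in S then c * c^* else 0).
  have h := ell2_inner_has_sum w (translate s w).
  apply: has_sum_unique h _.
  under [X in has_sum X _]eq_fun do rewrite entry_translate !wE.
  rewrite (eq_big_seq (fun x =>
    (if x \in S then c else 0) * (if (s^-1 * x)%g \in S then c else 0)^* )).
    by apply: has_sum_finite => x /negbTE ->; rewrite mul0r.
  by move=> x ->; case: ifP => _; rewrite // rmorph0 mulr0.
have -> : inner (rep_space (trivial_rep R L)) v (trivial_rep R L s v) =
    \sum_(x <- S) c * c^*.
  rewrite big_const_seq count_predT iter_addr_0 c2 -[RHS]mulr_natr divfK ?gt_eqF//.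
  by rewrite normCK.
rewrite -sumrB.
(* [A] is [S] minus [sS], one half of the symmetric difference in the Folner condition. *)
pose A := [fset x in S | (s^-1 * x)%g \notin S].
have -> : \sum_(x <- S) (c * c^* - (if (s^-1 * x)%g \in S then c * c^* else 0)) =
    c * c^* * #|` A|%:R.
  rewrite (eq_bigr (fun x => if (s^-1 * x)%g \notin S then c * c^* else 0))
    => [|x _]; last first.
    by case: ifP => _; rewrite ?subrr ?subr0.
  rewrite -big_mkcond big_fset_condE big_const_seq count_predT iter_addr_0.
  by rewrite mulr_natr.
rewrite c2 normrM ger0_norm ?divr_ge0 ?exprn_ge0 ?(ltW cS)// normr_nat.
have cA : #|` A|%:R <= ratr q * #|` S|%:R :> R.
  rewrite -(ratr_nat R #|` A|) -(ratr_nat R #|` S|) -rmorphM ler_rat.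
  apply: le_trans (SF _ sF); rewrite ler_nat; apply: fsubset_leq_card.
  apply/fsubsetP => x; rewrite !inE /= => /andP[xS sxS].
  apply/orP; right; rewrite xS andbT; apply: contra sxS => /imfsetP[y /= yS ->].
  by rewrite mulKg.
rewrite mulrAC -mulrA; apply: (@le_lt_trans _ _ (a%:C * (ratr q)%:C)).
  apply: ler_pM; rewrite ?exprn_ge0 ?divr_ge0 ?ler0n ?(ltW aE)//.
  rewrite ler_pdivrMr//.
  by rewrite -!(rmorph_nat (real_complex R)) -rmorphM lecR.
by rewrite -rmorphM ltcR mulrC -ltr_pdivlMr.
Qed.

End RegularRep.

Lemma infinite_amenable_not_T (R : realType) (L : groupType) :
  countable [set: L] -> infinite_set [set: L] -> amenable L -> ~ property_T R L.
Proof.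
move=> cL iL aL T.
have sep : separable (rep_space (regular_rep R L)) := ell2_separable R 1%g cL.
have [v [v0 vinv]] := T _ sep (regular_rep_weakly_contains_trivial aL).
exact/v0/regular_rep_invariant_eq0.
Qed.

Theorem theorem1p4 (R : realType) :
  (forall L : groupType, countable [set: L]%classic -> ~ property_T R L ->
    exists (G : groupType) (iota : L -> G),
      [/\ countable [set: G]%classic,
          injective iota,
          forall x y : L, iota (x * y)%g = (iota x * iota y)%g &
          flabby_pair R (range iota)])
  /\
  (forall L : groupType, countable [set: L]%classic ->
    infinite_set [set: L]%classic -> amenable L -> ~ property_T R L).
Proof.
split=> L; first exact: flabby_embedding.
exact: infinite_amenable_not_T.
Qed.
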